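(* Let $0<s<\infty$ and let $(X,\mathscr{B},\mu,\rho)$ be a compact Ahlfors $s$-regular probability space. Let $\{B_n\}_{n\ge1}$ be a sequence of balls in $X$ with $\operatorname{diam} B_n$ decreasing to $0$ as $n\to\infty$. For each $n\ge1$ let $E_n$ be a nonempty open subset of $B_n$, and let \[\lambda=\sup\Big\{t\ge0\colon \sup_{n\ge1}\frac{I_t(\mu,E_n)\,\mu(B_n)}{\mu(E_n)^2}<\infty\Big\}.\] If $\mu\big(\limsup_{n\to\infty}B_n\big)=1$, then $\dim_{\rm H}\big(\limsup_{n\to\infty}E_n\big)\ge\lambda$ and $\dim_{\rm P}\big(\limsup_{n\to\infty}E_n\big)=s$.
   Context: For a metric space $(X,\rho)$, $B(x,r)=\{y\in X:\rho(x,y)<r\}$; a ball is an open ball $B(x,r)$ with given centre $x$ and radius $r>0$. $\mathscr{B}$ is the Borel $\sigma$-algebra. A Borel measure $\mu$ is Ahlfors $s$-regular ($0<s<\infty$) if there is $1\le C<\infty$ with $C^{-1}r^s\le\mu(B(x,r))\le Cr^s$ for all $x\in X$ and $0<r\le\operatorname{diam}X$. A compact Ahlfors $s$-regular probability space $(X,\mathscr{B},\mu,\rho)$ means: $(X,\rho)$ is a compact metric space and $\mu$ is an Ahlfors $s$-regular Borel probability measure on it. For $t\ge0$ and $U\in\mathscr{B}$, $I_t(\mu,U)=\int_U\int_U\rho(x,y)^{-t}\,d\mu(x)\,d\mu(y)\in[0,\infty]$. For sets $F_n$, $\limsup_{n\to\infty}F_n=\bigcap_{m\ge1}\bigcup_{n\ge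 m}F_n$. $\dim_{\rm H}$ and $\dim_{\rm P}$ denote Hausdorff and packing dimension. *)

(* Defs.v *)
From HB Require Import structures.
From mathcomp Require Import all_boot all_order all_algebra.
From mathcomp Require Import all_classical all_reals all_analysis.

Set Implicit Arguments.
Unset Strict Implicit.
Unset Printing Implicit Defensive.

Import Order.TTheory GRing.Theory Num.Theory.
Import numFieldNormedType.Exports.

Local Open Scope classical_set_scope.
Local Open Scope ring_scope.
Local Open Scope ereal_scope.

(* The base point is required by the library's measurable types; it carries no
   information, as a space with a probability measure is nonempty. *)
#[short(type="pmetricType")]
HB.structure Definition PointedMetricSpace (K : numDomainType) :=
  {M of Metric K M & Pointed M}.

Definition borelType (R : realType) (X : pmetricType R) :=
  g_sigma_algebraType (@open X).

Section diameter_and_dimensions.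
Context {R : realType} {X : pmetricType R}.
Implicit Types (A : set X) (t : R).

(* The element 0 is only there to make the diameter of the empty set 0. *)
Definition diam A : \bar R :=
  ereal_sup (0 |` [set (mdist x y)%:E | x in A & y in A]).

(* Empty covering sets are skipped, so that they contribute 0 also for t = 0,
   where 0 `^ 0 = 1; a nonempty set of diameter 0 contributes 1 for t = 0. *)
Definition hausdorff_content t (delta : R) A : \bar R :=
  ereal_inf [set \esum_(i in [set i | U i !=set0]) poweR (diam (U i)) t |
    U in [set U : (set X)^nat |
      A `<=` \bigcup_i U i /\ forall i, diam (U i) <= delta%:E]].

Definition hausdorff_measure t A : \bar R :=
  ereal_sup [set hausdorff_content t delta A |
    delta in [set delta : R | (0 < delta)%R]].

Definition hausdorff_dim A : \bar R :=
  ereal_inf [set t%:E | t in [set t : R |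
    (0 <= t)%R /\ hausdorff_measure t A = 0]].

(* [I], [c], [r] describe an at most countable family of balls [B(c i, r i)],
   [i] in [I]. *)
Definition is_packing (delta : R) A (I : set nat) (c : nat -> X)
    (r : nat -> R) : Prop :=
  (forall i, I i -> [/\ A (c i), (0 < r i)%R & (r i <= delta)%R]) /\
  trivIset I (fun i => ball (c i) (r i)).

Definition prepacking_content t (delta : R) A : \bar R :=
  ereal_sup [set m | exists (I : set nat) (c : nat -> X) (r : nat -> R),
    is_packing delta A I c r /\ m = \esum_(i in I) ((2 * r i) `^ t)%:E].

Definition packing_premeasure t A : \bar R :=
  ereal_inf [set prepacking_content t delta A |
    delta in [set delta : R | (0 < delta)%R]].

Definition packing_measure t A : \bar R :=
  ereal_inf [set \sum_(0 <= i <oo) packing_premeasure t (F i) |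
    F in [set F : (set X)^nat | A `<=` \bigcup_i F i]].

Definition packing_dim A : \bar R :=
  ereal_inf [set t%:E | t in [set t : R |
    (0 <= t)%R /\ packing_measure t A = 0]].

End diameter_and_dimensions.

Section measures.
Context {R : realType} {X : pmetricType R}.
Variable mu : {measure set (borelType X) -> \bar R}.

Definition ahlfors_regular (s : R) : Prop :=
  exists2 C : R, (1 <= C)%R &
    forall (x : X) (r : R), (0 < r)%R -> r%:E <= diam [set: X] ->
      (C^-1 * r `^ s)%:E <= mu (ball x r) <= (C * r `^ s)%:E.

(* rho^{-t} is written as (rho^{-1})^t in the extended reals: as [0^-1 = +oo]
   there, the kernel on the diagonal is [+oo] for [t > 0] and [1] for [t = 0],
   whereas [powR 0 (- t)] would be 0. *)
Definition energy (t : R) (U : set X) : \bar R :=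
  \int[mu]_(y in U) \int[mu]_(x in U)
    poweR ((mdist (x : X) (y : X))%:E)^-1 t.

Definition energy_exponent (B E : (set X)^nat) : \bar R :=
  ereal_sup [set t%:E | t in [set t : R | (0 <= t)%R /\
    ereal_sup [set energy t (E n) * mu (B n) / (mu (E n) ^+ 2) |
      n in [set: nat]] < +oo]].

End measures.

(* Main.v *)
Require Import Defs.
From mathcomp Require Import all_boot all_order all_algebra.
From mathcomp Require Import all_classical all_reals all_analysis.
From mathcomp Require Import ring lra.

Set Implicit Arguments.
Unset Strict Implicit.
Unset Printing Implicit Defensive.

Import Order.TTheory GRing.Theory Num.Theory.
Import numFieldNormedType.Exports.

Local Open Scope classical_set_scope.
Local Open Scope ring_scope.
Local Open Scope ereal_scope.

(** The two dimension statements rest on different properties of the limsup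
    set F of the sets E n.

    Packing dimension. Regularity bounds the sum of the s-th powers of the
    radii in any packing by small balls, so every t > s has zero packing measure and
    packing_dim_le holds for all sets. Conversely, since the limsup of the balls
    has full measure and every ball has positive measure, each nonempty open
    set contains arbitrarily late balls B n, and hence sets E n; so F is a dense
    G_delta set. By a Baire argument, in any countable cover of F some
    member A is dense in a nonempty open set V. By volume counting, A
    contains about d^-s points that are 2d-separated, and the
    corresponding packings by balls of radius d have t-sums of order d^(t-s),
    which is unbounded for t < s (packing_dim_ge).

    Hausdorff dimension. Let t be an exponent for which the energy ratios are
    bounded by M, and let u < t. A Chebyshev argument (trimmed_set) replaces
    E n by a subset E' n of comparable measure on which the t-potential is
    small, so that the normalized restriction of mu to E' n gives a ball of
    radius rho a mass of order at most rho^t / mu (B n). Moreover t <= s,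
    because the energy of a nonempty open set is infinite beyond s
    (energy_infty), so u < s.
    A Cantor construction then produces open sets V 0, V 1, ... with the
    closure of V (j+1) inside V j and V (j+1) inside a union of sets E n with
    n >= j, and measures nu j carried by V j, of mass greater than 1/2, such
    that nu j (ball y rho) <= C (2 rho)^u for all j. In one step
    (refine_pair) one selects well separated balls B m of small radius inside
    V, whose fivefold enlargements cover almost all of the mass of nu
    (select_balls), cuts the enlargements into disjoint cells, and moves the
    mass of each cell onto E' m. At scales above a threshold eta this only
    shifts mass by a distance much smaller than eta; at scales below eta the
    measure nu has bounded density, and the exponents t > u and s > u leave
    room to absorb all constants (refined_frostman). Hence the Frostman
    constant deteriorates by as little as one wishes in each step.

    Compactness replaces the passage to a limit measure: if the balls
    ball (x i) (rho i) cover F, they cover the intersection of the V j, so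
    finitely many of them cover some V j (nested_cover), and the bound for
    nu j gives 1/2 < sum of C (2 rho i)^u (limsup_covering_sum). A set with
    zero v-dimensional Hausdorff measure, v < u, has covers for which that
    sum is arbitrarily small (hausdorff_measure0_cover), a contradiction. *)

(** * Nested sequences of open sets *)

Section nested_sequences.
Context {T : topologicalType}.

(** Dependent choice for both Cantor constructions below: the state is an
    open set in the Baire argument, and an open set with a measure in the
    construction of Frostman measures. *)
Lemma nested_choice {S : Type} (V : S -> set T) (P : S -> Prop)
    (G : nat -> set T) (x0 : S) :
  P x0 ->
  (forall j x, P x ->
    exists y, [/\ P y, closure (V y) `<=` V x & V y `<=` G j]) ->
  exists f : nat -> S, forall j,
    [/\ P (f j), closure (V (f j.+1)) `<=` V (f j) & V (f j.+1) `<=` G j].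
Proof.
move=> Px0 step.
have /choice[g gP] (p : nat * {x | P x}) : exists y : {x | P x},
    closure (V (sval y)) `<=` V (sval p.2) /\ V (sval y) `<=` G p.1.
  case: p => j [x Px] /=; have [y [Py Vy Gy]] := step j x Px.
  by exists (exist _ y Py).
pose f := fix f n := if n is m.+1 then g (m, f m) else exist _ x0 Px0.
exists (fun j => sval (f j)) => j; have [? ?] := gP (j, f j).
by split => //; exact: (svalP (f j)).
Qed.

(** Otherwise pick x n in V n outside the first n sets of the cover. A cluster
    point of x lies in the closure of every V j, hence in all V j and in some
    O i, which x leaves from index i on. *)
Lemma nested_cover (V O : nat -> set T) : compact [set: T] ->
  (forall j, closure (V j.+1) `<=` V j) ->
  (forall i, open (O i)) ->
  \bigcap_j V j `<=` \bigcup_i O i ->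
  exists n, V n `<=` \bigcup_(i < n) O i.
Proof.
move=> cT clV oO VO; apply: contrapT => /forallNP nV.
have /choice[x xP] n : exists x, V n x /\ ~ (\bigcup_(i < n) O i) x.
  by have /existsNP[x /not_implyP ?] := nV n; exists x.
have Vdec m n : (m <= n)%N -> V n `<=` V m.
  move=> /subnK <-; elim: (n - m)%N => [//|k IH].
  by rewrite addSn; apply: subset_trans IH => y Vy; exact/clV/subset_closure.
have [p [_ clp]] := cT (x @ \oo) _ filterT.
have Vp j : V j p.
  apply: clV => A Ap; apply: clp Ap.
  exists j.+1 => // n /= jn; exact: (Vdec _ _ jn _ (xP n).1).
have [i _ Oip] := VO p (fun j _ => Vp j).
have [y [yA Oy]] := clp (x @` [set n | (i < n)%N]) (O i)
  (ex_intro2 _ _ i.+1 Logic.I (fun n ni => ex_intro2 _ _ n ni erefl))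
  (open_nbhs_nbhs (conj (oO i) Oip)).
case: yA Oy => n /= ni <- Oy.
by apply: (xP n).2; exists i.
Qed.

Lemma nested_nonempty (V : nat -> set T) : compact [set: T] ->
  (forall j, closure (V j.+1) `<=` V j) -> (forall j, V j !=set0) ->
  \bigcap_j V j !=set0.
Proof.
move=> cT clV V0; apply: contrapT => /nonemptyPn V00.
have [|n Vn] := @nested_cover V (fun=> set0) cT clV (fun=> open0).
  by rewrite V00.
by have [x /Vn[]] := V0 n.
Qed.

End nested_sequences.

(** * Balls in a metric space *)

Section metric_balls.
Context {R : realType} {X : pmetricType R}.
Implicit Types (x y z : X) (r : R).

Lemma in_ball x r y : ball x r y <-> (mdist x y < r)%R.
Proof. by rewrite ballEmdist. Qed.

Lemma sub_ball x r y r' : (mdist x y + r' <= r)%R -> ball y r' `<=` ball x r.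
Proof.
move=> h z /in_ball yz; apply/in_ball.
by apply: le_lt_trans (metric_triangle x y z) _; lra.
Qed.

Lemma closure_ball_sub x r r' : (r < r')%R -> closure (ball x r) `<=` ball x r'.
Proof.
move=> rr' y /(_ (ball y (r' - r)))[|z [/in_ball xz /in_ball yz]].
  by apply: nbhsx_ballx; rewrite subr_gt0.
apply/in_ball; have := metric_triangle x z y; rewrite (metric_sym z y); lra.
Qed.

Lemma open_ball_sub (V : set X) x : open V -> V x ->
  exists2 e : R, (0 < e)%R & ball x e `<=` V.
Proof.
move=> oV Vx; have /nbhs_ballP[e /= e0 eV] : nbhs x V.
  by apply: open_nbhs_nbhs; split.
by exists e.
Qed.

Lemma measurable_open (U : set X) : open U -> measurable (U : set (borelType X)).
Proof. by move=> oU; exact: sub_sigma_algebra. Qed.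

Lemma open_from_balls (V : set X) :
  (forall x, V x -> exists2 e : R, (0 < e)%R & ball x e `<=` V) -> open V.
Proof.
move=> VP; rewrite openE => x /VP[e e0 eV].
by apply/nbhs_ballP; exists e.
Qed.

Lemma open_ballB x r : open (ball x r).
Proof.
apply: open_from_balls => y /in_ball xy.
exists (r - mdist x y)%R; first by rewrite subr_gt0.
by apply: sub_ball; lra.
Qed.

Lemma measurable_ballB x r : measurable (ball x r : set (borelType X)).
Proof. by apply: measurable_open; exact: open_ballB. Qed.

Lemma le_diam (A : set X) x y : A x -> A y -> (mdist x y)%:E <= diam A.
Proof.
by move=> Ax Ay; apply: ereal_sup_ubound; right; exists x => //; exists y.
Qed.

Lemma diam_ge0 (A : set X) : 0 <= diam A.
Proof. by apply: ereal_sup_ubound; left. Qed.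

End metric_balls.

(** * Ahlfors regular measures *)

Section real_powers.
Context {R : realType}.

Lemma powR_split (a b p : R) : (0 < p)%R ->
  (p `^ b = p `^ (b - a) * p `^ a)%R.
Proof. by move=> p0; rewrite -powRD ?subrK// (gt_eqF p0) implybT. Qed.

Lemma powR_small (A a e : R) : (0 < a)%R -> (0 < e)%R ->
  exists2 h : R, (0 < h)%R & forall p, (0 < p)%R -> (p < h)%R ->
    (A * p `^ a <= e)%R.
Proof.
move=> a0 e0; pose B : R := (`|A| + 1)%R.
have B0 : (0 < B)%R by rewrite ltr_wpDl.
exists ((e / B) `^ a^-1)%R; first by rewrite powR_gt0// divr_gt0.
move=> p p0 ph; apply: (@le_trans _ _ (B * p `^ a)%R).
  by rewrite ler_wpM2r ?powR_ge0// (le_trans (ler_norm _))// lerDl.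
rewrite -ler_pdivlMl// mulrC.
have := ltW ph; move/(ge0_ler_powR (ltW a0)).
rewrite -powRrM mulVf ?gt_eqF// powRr1.
  by apply; rewrite nnegrE ?powR_ge0// ltW.
by rewrite divr_ge0// ltW.
Qed.

End real_powers.

Section regularity.
Context {R : realType} {X : pmetricType R}.
Variable mu : {measure set (borelType X) -> \bar R}.

Definition upper_regular (s C : R) : Prop := forall (x : X) (r : R),
  (0 < r)%R -> mu (ball x r) <= (C * r `^ s)%:E.

Definition lower_regular (s C D : R) : Prop := forall (x : X) (r : R),
  (0 < r)%R -> (r <= D)%R -> (C^-1 * r `^ s)%:E <= mu (ball x r).

Lemma le_borel_measure (A B : set X) : measurable (A : set (borelType X)) ->
  measurable (B : set (borelType X)) -> A `<=` B -> mu A <= mu B.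
Proof. by move=> mA mB AB; apply: le_measure; rewrite ?inE. Qed.

Lemma ball_measure_gt0 s C D x r : (1 <= C)%R -> (0 < D)%R -> lower_regular s C D ->
  (0 < r)%R -> 0 < mu (ball x r).
Proof.
move=> C1 D0 lo r0.
have m0 : (0 < Num.min r D)%R by rewrite lt_min r0.
apply: lt_le_trans (_ : mu (ball x (Num.min r D)) <= _).
  apply: lt_le_trans (lo x _ m0 _); last by rewrite ge_min lexx orbT.
  by rewrite lte_fin mulr_gt0 ?invr_gt0 ?powR_gt0//; lra.
apply: le_borel_measure; try exact: measurable_ballB.
by apply: sub_ball; rewrite mdistxx add0r ge_min lexx.
Qed.

Lemma open_measure_gt0 s C D (U : set X) : (1 <= C)%R -> (0 < D)%R ->
  lower_regular s C D -> open U -> U !=set0 -> 0 < mu U.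
Proof.
move=> C1 D0 lo oU [x Ux]; have [e e0 eU] := open_ball_sub oU Ux.
apply: lt_le_trans (ball_measure_gt0 x C1 D0 lo e0) _.
by apply: le_borel_measure => //; [exact: measurable_ballB|exact: measurable_open].
Qed.

End regularity.

Section ahlfors.
Context {R : realType} {X : pmetricType R}.
Variable mu : probability (borelType X) R.

(** Replacing C by the maximum of C and D^-s makes the upper bound
    hold for all radii, since mu is at most 1. *)
Lemma ahlfors_bounds (s : R) : (0 < s)%R -> 0 < diam [set: X] ->
  ahlfors_regular mu s -> exists C D : R,
  [/\ (1 <= C)%R, (0 < D)%R, upper_regular mu s C & lower_regular mu s C D].
Proof.
move=> s0 d0 [C C1 reg].
have [D D0 Dd] : exists2 D : R, (0 < D)%R & D%:E <= diam [set: X].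
  move: d0; case: (diam [set: X]) => [d| |] //= d0; first by exists d.
  by exists 1%R; rewrite ?leey.
have C0 : (0 < C)%R by lra.
exists (Num.max C (D `^ (- s)))%R, D; split => //.
- by rewrite le_max C1.
- move=> x r r0; have [rD|Dr] := leP r D.
    have rd : r%:E <= diam [set: X] by apply: le_trans Dd; rewrite lee_fin.
    have /andP[_ h] := reg x r r0 rd; apply: le_trans h _.
    by rewrite lee_fin ler_wpM2r ?powR_ge0// le_max lexx.
  apply: le_trans (probability_le1 _ (measurable_ballB x r)) _.
  rewrite lee_fin; apply: (@le_trans _ _ (D `^ (- s) * r `^ s)%R).
    rewrite powRN mulrC ler_pdivlMr ?powR_gt0// mul1r.
    by rewrite ge0_ler_powR ?nnegrE//; lra.
  by rewrite ler_wpM2r ?powR_ge0// le_max lexx orbT.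
- move=> x r r0 rD.
  have rd : r%:E <= diam [set: X] by apply: le_trans Dd; rewrite lee_fin.
  have /andP[h _] := reg x r r0 rd; apply: le_trans h.
  rewrite lee_fin ler_wpM2r ?powR_ge0// lef_pV2 ?posrE// ?lt_max ?C0//.
  by rewrite le_max lexx.
Qed.

End ahlfors.

(** * Upper bound for the packing dimension *)

Section packing.
Context {R : realType} {X : pmetricType R}.
Variable mu : probability (borelType X) R.
Variables (s C D : R).
Hypotheses (s0 : (0 < s)%R) (C1 : (1 <= C)%R) (D0 : (0 < D)%R).
Hypotheses (up : upper_regular mu s C) (lo : lower_regular mu s C D).

Let C0 : (0 < C)%R. Proof. exact: lt_le_trans C1. Qed.

(** Each ball of the packing has measure at least r^s / C and the balls are
    disjoint, so the sum of the r^s is at most C; the factor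
    r^(t - s) <= delta^(t - s) is then taken out of the sum. *)
Lemma prepacking_content_le (t delta : R) (A : set X) :
  (s < t)%R -> (0 < delta)%R -> (delta <= D)%R ->
  prepacking_content t delta A <= (2 `^ t * C * delta `^ (t - s))%:E.
Proof.
move=> st d0 dD; apply: ge_ereal_sup => _ [I [c [r [[Ir tI] ->]]]].
set K := (2 `^ t * C * delta `^ (t - s))%R.
have K0 : (0 <= K)%R by rewrite !mulr_ge0 ?powR_ge0//; exact: ltW.
apply: (@le_trans _ _ (\esum_(i in I) (K%:E * mu (ball (c i) (r i))))).
  apply: le_esum => i Ii; have [Ai ri0 rid] := Ir i Ii.
  apply: (@le_trans _ _ (K%:E * (C^-1 * r i `^ s)%:E)); last first.
    by rewrite lee_wpmul2l// lo// (le_trans rid).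
  rewrite -EFinM lee_fin /K.
  rewrite powRM//; last exact: ltW.
  rewrite (powR_split s t ri0).
  have h : (r i `^ (t - s) <= delta `^ (t - s))%R.
    by rewrite ge0_ler_powR ?nnegrE//; lra.
  have rs0 := powR_ge0 (r i) s; have t0 := powR_ge0 2 t.
  rewrite [leRHS](_ : _ = 2 `^ t * (delta `^ (t - s) * r i `^ s))%R.
    by rewrite ler_wpM2l// ler_wpM2r.
  by field; rewrite gt_eqF.
rewrite -[I](set_mem_set I) -nneseries_esum; last first.
  by move=> n _; rewrite mule_ge0.
rewrite nneseriesZl//.
rewrite -measure_bigcup//; last by move=> i _; exact: measurable_ballB.
rewrite -[leRHS]mule1 lee_wpmul2l//; apply: probability_le1.
by apply: bigcup_measurable => i _; exact: measurable_ballB.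
Qed.

Lemma packing_premeasure_ge0 (t : R) (A : set X) : 0 <= packing_premeasure t A.
Proof.
apply: le_ereal_inf_tmp => _ [d d0 <-].
apply: ereal_sup_ubound; exists set0, (fun=> point), (fun=> 1%R).
by rewrite esum_set0; split => //; split => //; exact: trivIset_set0.
Qed.

Lemma packing_dim_le (A : set X) : packing_dim A <= s%:E.
Proof.
apply/lee_addgt0Pr => e e0; rewrite -EFinD; apply: ereal_inf_lbound.
exists (s + e)%R => //; split; first by rewrite addr_ge0// ltW.
apply/eqP; rewrite eq_le; apply/andP; split; last first.
  apply: le_ereal_inf_tmp => _ [F _ <-]; apply: nneseries_ge0 => i _ _.
  exact: packing_premeasure_ge0.
apply: ereal_inf_lbound; exists (fun=> setT); first by exists 0%N.
rewrite eseries0// => i _ _; apply/eqP.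
rewrite eq_le packing_premeasure_ge0 andbT.
apply/lee_addgt0Pr => h h0; rewrite add0e.
  have [k k0 kP] := powR_small (2 `^ (s + e) * C) e0 h0.
  pose d := (Num.min (k / 2) D)%R.
  have d0 : (0 < d)%R by rewrite lt_min D0 divr_gt0.
  have dk : (d < k)%R by rewrite gt_min; apply/orP; left; lra.
  apply: (@le_trans _ _ (prepacking_content (s + e) d setT)).
    by apply: ereal_inf_lbound; exists d.
  apply: le_trans (prepacking_content_le _ _ d0 _) _.
  - by rewrite ltrDl.
  - by rewrite ge_min lexx orbT.
  - by rewrite lee_fin (_ : s + e - s = e)%R ?kP//; lra.
Qed.

End packing.

(** * Small balls inside open sets *)

Section balls_shrink.
Context {R : realType} {X : pmetricType R}.
Variable mu : probability (borelType X) R.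
Variables (s C D : R).
Hypotheses (s0 : (0 < s)%R) (C1 : (1 <= C)%R) (D0 : (0 < D)%R).
Hypotheses (up : upper_regular mu s C) (lo : lower_regular mu s C D).

Let C0 : (0 < C)%R. Proof. exact: lt_le_trans C1. Qed.

(** The given radius of a ball may exceed its diameter. If r n stays above
    e while the diameter is small, then the ball of radius min e D about c n
    is contained in a ball of tiny radius, against the two regularity bounds. *)
Lemma radius_small (c : nat -> X) (r : nat -> R) :
  (forall n, (0 < r n)%R) ->
  diam (ball (c n) (r n)) @[n --> \oo] --> 0 ->
  forall e, (0 < e)%R -> exists N, forall n, (N <= n)%N -> (r n < e)%R.
Proof.
move=> r0 dr e e0; pose e' := (Num.min e D)%R.
have e'0 : (0 < e')%R by rewrite lt_min e0.
have b0 : (0 < (2 * C)^-1 * (C^-1 * e' `^ s))%R.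
  by rewrite !mulr_gt0 ?invr_gt0 ?powR_gt0// mulr_gt0.
have [h h0 hP] := powR_small 1 s0 b0.
have /dr : nbhs (0 : \bar R) [set y | y < (h / 2)%:E].
  by apply: open_ereal_lt'; rewrite lte_fin divr_gt0.
move=> [N _ NP]; exists N => n Nn; rewrite ltNge; apply/negP => ern.
have dn : diam (ball (c n) (r n)) < (h / 2)%:E by exact: (NP n Nn).
have h20 : (0 < h / 2)%R by rewrite divr_gt0.
have sub : ball (c n) e' `<=` ball (c n) (h / 2).
  move=> y cy; apply/in_ball; rewrite -lte_fin; apply: le_lt_trans dn.
  apply: le_diam; first exact: ballxx.
  by apply: le_ball cy; rewrite ge_min ern.
have /(le_trans (lo (c n) e'0 _)) :=
  le_borel_measure mu (measurable_ballB _ _) (measurable_ballB _ _) sub.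
rewrite ge_min lexx orbT => /(_ isT) /le_trans /(_ (up (c n) h20)).
rewrite lee_fin => le1.
have h2h : (h / 2 < h)%R by lra.
have := hP _ h20 h2h; rewrite mul1r => le2.
have : (C^-1 * e' `^ s <= C * ((2 * C)^-1 * (C^-1 * e' `^ s)))%R.
  by apply: le_trans le1 _; rewrite ler_wpM2l// ltW.
rewrite [X in (_ <= X)%R](_ : _ = 2^-1 * (C^-1 * e' `^ s))%R; last first.
  by field; rewrite gt_eqF.
have : (0 < C^-1 * e' `^ s)%R by rewrite mulr_gt0 ?invr_gt0 ?powR_gt0.
lra.
Qed.

Lemma measurable_limsup_balls (c : nat -> X) (r : nat -> R) :
  measurable (lim_sup_set (fun n => ball (c n) (r n)) : set (borelType X)).
Proof.
apply: bigcap_measurable => [|n _]; first by exists 0%N.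
by apply: bigcup_measurable => j _; exact: measurable_ballB.
Qed.

Lemma small_ball_in (c : nat -> X) (r : nat -> R) (V : set X) x :
  (forall e, (0 < e)%R -> exists N, forall n, (N <= n)%N -> (r n < e)%R) ->
  open V -> V x ->
  exists N, forall n, (N <= n)%N -> ball (c n) (r n) x ->
    closure (ball (c n) (r n)) `<=` V.
Proof.
move=> rsmall oV Vx; have [e e0 eV] := open_ball_sub oV Vx.
have [N NP] := rsmall (e / 3)%R (divr_gt0 e0 (ltr0Sn _ _)).
exists N => n Nn nx; have rn := NP n Nn.
apply: subset_trans eV; apply: subset_trans (@closure_ball_sub _ _ _ _ (e / 2) _) _.
  by lra.
by move/in_ball: nx; rewrite metric_sym => nx; apply: sub_ball; lra.
Qed.

(** The limsup of the balls has full measure, so it meets every nonempty open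
    set. *)
Lemma exists_ball_in (c : nat -> X) (r : nat -> R) (V : set X) m :
  (forall e, (0 < e)%R -> exists N, forall n, (N <= n)%N -> (r n < e)%R) ->
  mu (lim_sup_set (fun n => ball (c n) (r n))) = 1 ->
  open V -> V !=set0 ->
  exists2 n, (m <= n)%N & closure (ball (c n) (r n)) `<=` V.
Proof.
move=> rsmall limB oV V0; set L := lim_sup_set _ in limB.
have mL : measurable (L : set (borelType X)) by exact: measurable_limsup_balls.
have [x [Vx Lx]] : V `&` L !=set0.
  apply: contrapT => /nonemptyPn VL.
  have := open_measure_gt0 C1 D0 lo oV V0; rewrite ltNge => /negP; apply.
  rewrite -(_ : mu (~` L) = 0); last first.
    by rewrite probability_setC// limB subee.
  apply: le_borel_measure; [exact: measurable_open|exact: measurableC|].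
  exact/disjoints_subset.
have [N NP] := small_ball_in c rsmall oV Vx.
have [n /= mn nx] := Lx (maxn m N) Logic.I.
exists n; first exact: leq_trans (leq_maxl _ _) mn.
exact: NP (leq_trans (leq_maxr _ _) mn) nx.
Qed.

End balls_shrink.

(** * Lower bound for the packing dimension *)

Lemma measure_le_sum {R : realType} {X : pmetricType R}
    (nu : {measure set (borelType X) -> \bar R}) n (A : set X)
    (F : nat -> set X) :
  measurable (A : set (borelType X)) ->
  (forall i, measurable (F i : set (borelType X))) ->
  A `<=` \bigcup_(i < n) F i -> nu A <= \sum_(i < n) nu (F i).
Proof.
move=> mA mF; rewrite bigcup_mkord => AF.
apply: le_trans (Boole_inequality nu _ ) => //.
by apply: le_borel_measure => //; exact: bigsetU_measurable.
Qed.

Section packing_lower.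
Context {R : realType} {X : pmetricType R}.
Variable mu : probability (borelType X) R.
Variables (s C D : R).
Hypotheses (C1 : (1 <= C)%R) (D0 : (0 < D)%R).
Hypotheses (up : upper_regular mu s C) (lo : lower_regular mu s C D).

Let C0 : (0 < C)%R. Proof. exact: lt_le_trans C1. Qed.

(** If no such y exists, the balls of radius 3d about the points x i cover
    ball x0 rho, whose measure is too large. The third d pays for
    moving from a point of the ball to a point of A. *)
Lemma next_separated (A : set X) x0 rho d n (x : nat -> X) :
  (0 < d)%R -> ball x0 rho `<=` closure A ->
  (n%:R * (C * (3 * d) `^ s))%:E < mu (ball x0 rho) ->
  exists2 y, A y & forall i, (i < n)%N -> (2 * d < mdist (x i) y)%R.
Proof.
move=> d0 bA nb; have d3 : (0 < 3 * d)%R by rewrite mulr_gt0.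
have [z [bz zx]] : exists z, ball x0 rho z /\
    forall i, (i < n)%N -> (3 * d <= mdist (x i) z)%R.
  apply: contrapT => /forallNP noz; move: nb; rewrite ltNge => /negP; apply.
  apply: (@le_trans _ _ (\sum_(i < n) mu (ball (x i) (3 * d)))).
    apply: (measure_le_sum mu (F := fun i => ball (x i) (3 * d))) => [|i|z bz].
    - exact: measurable_ballB.
    - exact: measurable_ballB.
    apply: contrapT => nz; apply: (noz z); split => // i ilt.
    rewrite leNgt; apply/negP => xz; apply: nz; exists i => //.
    exact/in_ball.
  apply: (@le_trans _ _ (\sum_(i < n) (C * (3 * d) `^ s)%:E)).
    by apply: lee_sum => i _; exact: up.
  by rewrite sumEFin lee_fin sumr_const card_ord [leRHS]mulr_natl.
have [y [Ay /in_ball zy]] := bA z bz (ball z d) (nbhsx_ballx z d d0).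
exists y => // i ilt; have := zx i ilt; have := metric_triangle (x i) y z.
rewrite (metric_sym y z); lra.
Qed.

Lemma exists_separated (A : set X) x0 rho d n :
  (0 < d)%R -> ball x0 rho `<=` closure A ->
  (n%:R * (C * (3 * d) `^ s))%:E < mu (ball x0 rho) ->
  exists x : nat -> X, (forall i, (i <= n)%N -> A (x i)) /\
    forall i j, (i < j)%N -> (j <= n)%N -> (2 * d < mdist (x i) (x j))%R.
Proof.
move=> d0 bA; elim: n => [|n IH] nb.
  have [y Ay _] := @next_separated A x0 rho d 0%N (fun=> point) d0 bA nb.
  by exists (fun=> y); split => // i [|j].
have [|x [xA xs]] := IH.
  apply: le_lt_trans nb; rewrite lee_fin ler_wpM2r ?ler_nat//.
  by rewrite mulr_ge0 ?powR_ge0// ltW.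
have [y Ay ys] := next_separated x d0 bA nb.
exists (fun i => if (i <= n)%N then x i else y); split.
  by move=> i _; case: ifPn => // iN; exact: xA.
move=> i j ij; rewrite leq_eqVlt => /predU1P[ej|jn].
  by rewrite ej ltnn -ltnS -ej ij; apply: ys; rewrite -ej.
by rewrite ltnS in jn; rewrite jn (leq_trans (ltnW ij) jn); exact: xs.
Qed.

(** At least a multiple of d^-s points of A are 2d-separated; balls of radius d
    about them form a packing whose t-sum is of order d^(t - s). *)
Lemma packing_premeasure_infty (A V : set X) t :
  (0 <= t)%R -> (t < s)%R -> open V -> V !=set0 -> V `<=` closure A ->
  packing_premeasure t A = +oo.
Proof.
move=> t0 ts oV [x0 Vx0] VA.
have [e e0 eV] := open_ball_sub oV Vx0.
pose rho := Num.min e D.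
have rho0 : (0 < rho)%R by rewrite lt_min e0.
have bA : ball x0 rho `<=` closure A.
  move=> y /in_ball xy; apply/VA/eV/in_ball; apply: lt_le_trans xy _.
  by rewrite ge_min lexx.
have := lo x0 rho0; rewrite {1}/rho ge_min lexx orbT => /(_ isT) lob.
set b := (C^-1 * rho `^ s)%R in lob.
have b0 : (0 < b)%R by rewrite mulr_gt0 ?invr_gt0 ?powR_gt0.
pose k := (b / 2 / (C * 3 `^ s))%R.
have k0 : (0 < k)%R by rewrite !divr_gt0// mulr_gt0 ?powR_gt0.
apply/eqyP => M M0; apply: le_ereal_inf_tmp => _ [delta /= delta0 <-].
have st : (0 < s - t)%R by rewrite subr_gt0.
have [h h0 hP] := powR_small M st k0.
pose d := Num.min delta (h / 2)%R.
have d0 : (0 < d)%R by rewrite lt_min delta0 divr_gt0.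
have dd : (d <= delta)%R by rewrite ge_min lexx.
have dh : (d < h)%R by rewrite gt_min; apply/orP; right; lra.
pose a := (C * (3 * d) `^ s)%R.
have a0 : (0 < a)%R by rewrite mulr_gt0 ?powR_gt0// mulr_gt0.
(* Halving b makes the number N of points compatible with the strict
   inequality required to find one more point. *)
pose N := Num.trunc (b / 2 / a)%R.
have /andP[Nle Nlt] : (N%:R <= b / 2 / a < N.+1%:R)%R.
  by rewrite truncn_itv// !divr_ge0//; exact: ltW.
have Na : (N%:R * a)%:E < mu (ball x0 rho).
  apply: lt_le_trans lob; rewrite lte_fin; apply: (@le_lt_trans _ _ (b / 2)%R).
    by rewrite -ler_pdivlMr.
  by rewrite ltr_pdivrMr//; lra.
have [x [xA xs]] := exists_separated d0 bA Na.
apply: (@le_trans _ _ (\esum_(i in `I_N.+1) ((2 * d) `^ t)%:E)); last first.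
  apply: ereal_sup_ubound; exists `I_N.+1, x, (fun=> d); split => //; split.
    by move=> i /= iN; split => //; exact: xA.
  move=> i j /= iN jN [z [/in_ball xz /in_ball yz]].
  have := metric_triangle (x i) z (x j); rewrite (metric_sym z) => tri.
  have [ij|ji|//] := ltngtP i j; exfalso.
    by have := xs _ _ ij jN; lra.
  by have := xs _ _ ji iN; rewrite (metric_sym (x j)); lra.
rewrite esum_fset//; last first.
  by move=> i _; rewrite lee_fin powR_ge0.
rewrite -fsbig_ord sumEFin lee_fin sumr_const card_ord -[leRHS]mulr_natl.
have dt0 : (0 < (2 * d) `^ t)%R by rewrite powR_gt0// mulr_gt0.
apply: (@le_trans _ _ (b / 2 / a * (2 * d) `^ t)%R); last first.
  by rewrite ler_wpM2r// ltW.
rewrite /k /a powRM//; last exact: ltW.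
have ds0 : (0 < d `^ s)%R by rewrite powR_gt0.
have s30 : (0 < (3 : R) `^ s)%R by rewrite powR_gt0.
have dst : (M * d `^ s <= k * (2 * d) `^ t)%R.
  rewrite (powR_split t s d0) mulrA; apply: ler_pM => //.
  - by rewrite mulr_ge0 ?powR_ge0// ltW.
  - exact: powR_ge0.
  - exact: hP.
  - by rewrite ge0_ler_powR ?nnegrE//; lra.
rewrite [leRHS](_ : _ = k * (2 * d) `^ t / d `^ s)%R; last first.
  by rewrite /k; field; rewrite !gt_eqF.
by rewrite ler_pdivlMr.
Qed.

(** If no F j were dense in a nonempty open set, then nested open sets could be
    chosen inside the sets E n and off the closures of the F j; their common
    point would lie in the limsup set but in no F j. *)
Lemma packing_dim_ge (c : nat -> X) (r : nat -> R) (E : nat -> set X) :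
  compact [set: X] ->
  (forall e, (0 < e)%R -> exists N, forall n, (N <= n)%N -> (r n < e)%R) ->
  mu (lim_sup_set (fun n => ball (c n) (r n))) = 1 ->
  (forall n, [/\ open (E n), E n !=set0 & E n `<=` ball (c n) (r n)]) ->
  s%:E <= packing_dim (lim_sup_set E).
Proof.
move=> cX rsmall limB EB.
apply: le_ereal_inf_tmp => _ [t [t0 Pt0] <-].
rewrite lee_fin leNgt; apply/negP => ts.
suff : packing_measure t (lim_sup_set E) = +oo by rewrite Pt0.
apply/eqP; rewrite -leye_eq; apply: le_ereal_inf_tmp => _ [F AF <-].
have [j [V [oV V0 VF]]] : exists j V,
    [/\ open V, V !=set0 & V `<=` closure (F j)].
  apply: contrapT => nosub.
  have nd j V : open V -> V !=set0 -> (V `&` ~` closure (F j)) !=set0.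
    move=> oV V0; apply: contrapT => /nonemptyPn VF.
    by apply: nosub; exists j, V; split => //; apply/subsets_disjoint.
  have [|j V [oV V0]|f fP] := @nested_choice X (set X) id
      (fun V => open V /\ V !=set0)
      (fun j => \bigcup_(n >= j) E n `&` ~` closure (F j)) setT.
  - by split; [exact: openT|exists point].
  - have oW : open (V `&` ~` closure (F j)).
      by apply: openI => //; exact/closed_openC/closed_closure.
    have [n jn BW] := exists_ball_in C1 D0 lo j rsmall limB oW (nd j V oV V0).
    have [oE E0 EBn] := EB n; exists (E n); split => //.
    + by move=> x /(closure_subset EBn)/BW [].
    + move=> x Ex; split; first by exists n.
      by have [] := BW x (subset_closure (EBn x Ex)).
  have [x fx] := nested_nonempty cX (fun j => let: And3 _ h _ := fP j in h)
    (fun j => let: And3 (conj _ h) _ _ := fP j in h).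
  have fG j : f j.+1 `<=` \bigcup_(n >= j) E n `&` ~` closure (F j).
    by have [_ _ h] := fP j; exact: h.
  have [|i _ Fx] := AF x.
    by move=> n _; have [] := fG n x (fx n.+1 Logic.I).
  by have [_] := fG i x (fx i.+1 Logic.I); apply; exact: subset_closure.
rewrite (@eseries_pinfty _ _ _ j)// => [n _|].
  by rewrite gt_eqF// (lt_le_trans ltNy0 (packing_premeasure_ge0 _ _)).
exact: packing_premeasure_infty t0 ts oV V0 VF.
Qed.

End packing_lower.

(** * Sets of small potential *)

(** The integral of a nonnegative function is the supremum of the integrals of
    simple functions below it. In this generality the bound applies to the
    potential of a set, whose measurability would call for a study of the
    kernel on the product space. *)
Lemma integral_ge_mul d (T : measurableType d) (R : realType)
    (mu : {measure set T -> \bar R}) (D A : set T) (f : T -> \bar R) (a : R) :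
  measurable A -> A `<=` D -> (0 <= a)%R -> (forall x, D x -> 0 <= f x) ->
  (forall x, A x -> a%:E <= f x) ->
  a%:E * mu A <= \int[mu]_(x in D) f x.
Proof.
move=> mA AD a0 f0 af; rewrite -integral_cst// !ge0_integralE//.
apply: ge_ereal_sup => _ [h hA <-]; apply: ereal_sup_ubound; exists h => //.
move=> x; apply: le_trans (hA x) _; rewrite /patch.
case: ifPn => [/set_mem Ax|_]; first by rewrite mem_set//; [exact: af|exact: AD].
by case: ifPn => // /set_mem Dx; exact: f0.
Qed.

Section trimming.
Context {R : realType} {X : pmetricType R}.
Variable mu : probability (borelType X) R.

Lemma kernel_ge (t rho : R) (x y : X) : (0 < t)%R -> (0 < rho)%R ->
  ball y rho x -> (rho `^ (- t))%:E <= poweR ((mdist x y)%:E)^-1 t.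
Proof.
move=> t0 rho0 /in_ball; rewrite metric_sym => xy.
have -> : (rho `^ (- t) = rho^-1 `^ t)%R.
  by rewrite -powR_inv1 ?(ltW rho0)// -powRrM mulN1r.
rewrite -poweR_EFin.
apply: (@gt0_ler_poweR _ t (ltW t0) (rho^-1)%:E ((mdist x y)%:E)^-1).
- by rewrite in_itv/= leey lee_fin invr_ge0 ltW.
- by rewrite in_itv/= leey inve_ge0 lee_fin mdist_ge0.
- by rewrite inver; case: eqVneq => [_|d0]; rewrite ?leey// lee_fin
    lef_pV2 ?posrE ?(ltW xy)// lt_def d0 mdist_ge0.
Qed.

(** By continuity from below, a slightly smaller ball about y still has large
    measure, and it is contained in ball z rho for all z near y. *)
Lemma open_massive (E : set X) (a t : R) : measurable (E : set (borelType X)) ->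
  open [set y | exists2 rho : R, (0 < rho)%R &
    (a * rho `^ t)%:E < mu (E `&` ball y rho)].
Proof.
move=> mE; apply: open_from_balls => y [rho rho0 lt_a].
pose F n := E `&` ball y (rho - n.+1%:R^-1).
have mF n : measurable (F n : set (borelType X)).
  by apply: measurableI => //; exact: measurable_ballB.
have UF : \bigcup_n F n = E `&` ball y rho.
  apply/seteqP; split => [z [n _ [Ez /in_ball yz]]|z [Ez /in_ball yz]].
    split => //; apply/in_ball; apply: lt_le_trans yz _.
    by rewrite gerDl oppr_le0.
  have [n nP] := ltr_add_invr yz.
  by exists n => //; split => //; apply/in_ball; rewrite ltrBrDr.
have ndF : nondecreasing_seq F.
  move=> m n mn; apply/subsetPset => z [Ez /in_ball yz]; split => //.
  apply/in_ball; apply: lt_le_trans yz _; rewrite lerD2l lerN2 lef_pV2 ?posrE//.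
  by rewrite ler_nat.
have := nondecreasing_cvg_mu (mu := mu) mF (bigcup_measurable (fun n _ => mF n)) ndF.
rewrite UF => cvF.
have : nbhs (mu (E `&` ball y rho)) [set u | (a * rho `^ t)%:E < u].
  exact: open_ereal_gt'.
move=> /cvF[N _ /(_ N (leqnn N))] /= ltN.
exists (N.+1%:R^-1)%R => [|z /in_ball yz].
  by rewrite invr_gt0.
exists rho => //; apply: lt_le_trans ltN _; apply: le_borel_measure => //.
  by apply: measurableI => //; exact: measurable_ballB.
apply: setIS; apply: sub_ball; rewrite metric_sym.
by rewrite addrCA -[leRHS]addr0 lerD2l subr_le0 ltW.
Qed.

Lemma energy_le_ratio (t M : R) (B E : set X) :
  0 < mu E -> measurable (E : set (borelType X)) ->
  0 < mu B -> measurable (B : set (borelType X)) ->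
  energy mu t E * mu B / (mu E ^+ 2) <= M%:E ->
  energy mu t E <= (M * fine (mu E) ^+ 2 / fine (mu B))%:E.
Proof.
move=> E0 mE B0 mB.
have Efin : mu E \is a fin_num by exact: fin_num_measure.
have Bfin : mu B \is a fin_num by exact: fin_num_measure.
have [eE bE] := (esym (fineK Efin), esym (fineK Bfin)).
set e := fine (mu E) in eE *; set b := fine (mu B) in bE *.
have e20 : (0 < e ^+ 2)%R by rewrite exprn_gt0// fine_gt0// E0 ltey_eq Efin.
have b0 : (0 < b)%R by rewrite fine_gt0// B0 ltey_eq Bfin.
have k0 : (0 < b / e ^+ 2)%R by rewrite divr_gt0.
rewrite eE bE -EFin_expe inver (gt_eqF e20) -muleA -EFinM.
rewrite -lee_pdivlMr// -EFinM => /le_trans; apply.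
by rewrite lee_fin invf_div mulrA.
Qed.

(** On a small ball of radius rho about y inside E, the potential at y is at
    least rho^-t times rho^s / C, which is unbounded as rho tends to 0. *)
Lemma energy_infty (s C D t : R) (E : set X) :
  (1 <= C)%R -> (0 < D)%R -> lower_regular mu s C D ->
  (0 < t)%R -> (s < t)%R -> open E -> E !=set0 -> energy mu t E = +oo.
Proof.
move=> C1 D0 lo t0 st oE E0; have C0 : (0 < C)%R by lra.
have mE := measurable_open oE.
have mE0 := open_measure_gt0 C1 D0 lo oE E0.
have Efin : mu E \is a fin_num by exact: fin_num_measure.
have e0 : (0 < fine (mu E))%R by rewrite fine_gt0// mE0 ltey_eq Efin.
apply/eqyP => M M0; pose a := (M / fine (mu E))%R.
have a0 : (0 < a)%R by rewrite divr_gt0.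
apply: (@le_trans _ _ (a%:E * mu E)).
  by rewrite -(fineK Efin) -EFinM divfK// gt_eqF.
apply: integral_ge_mul => //.
- exact: ltW.
- by move=> y _; apply: integral_ge0 => x _; exact: poweR_ge0.
move=> y Ey; have [d d0 dE] := open_ball_sub oE Ey.
have st0 : (0 < t - s)%R by rewrite subr_gt0.
have Ci0 : (0 < C^-1)%R by rewrite invr_gt0.
have [h h0 hP] := powR_small a st0 Ci0.
pose rho := Num.min (Num.min d D) (h / 2)%R.
have rho0 : (0 < rho)%R by rewrite !lt_min d0 D0 divr_gt0.
have rhoh : (rho < h)%R by rewrite gt_min; apply/orP; right; lra.
apply: (@le_trans _ _ ((rho `^ (- t))%:E * mu (ball y rho))).
  apply: (@le_trans _ _ ((rho `^ (- t))%:E * (C^-1 * rho `^ s)%:E)); last first.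
    by rewrite lee_wpmul2l ?lee_fin ?powR_ge0// lo// !ge_min lexx orbT.
  rewrite -EFinM lee_fin powRN ler_pdivlMl ?powR_gt0//.
  rewrite (powR_split s t rho0) mulrAC ler_wpM2r ?powR_ge0//.
  by rewrite mulrC; exact: hP.
apply: integral_ge_mul => //.
- exact: measurable_ballB.
- by apply: subset_trans dE; apply: sub_ball; rewrite mdistxx add0r !ge_min lexx.
- exact: powR_ge0.
- by move=> x _; exact: poweR_ge0.
- by move=> x yx; exact: kernel_ge.
Qed.

(** Chebyshev's inequality for the potential. With a = 2 M mu(E) / mu(B), a
    point y such that mu (E `&` ball y rho) > a rho^t for some rho has
    potential at least a, so such points fill at most half of E. Balls centred
    off the remaining set E' are handled by doubling the radius. *)
Lemma trimmed_set (t M : R) (B E : set X) :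
  (0 < t)%R -> (0 < M)%R -> open E -> 0 < mu E ->
  measurable (B : set (borelType X)) -> 0 < mu B ->
  energy mu t E * mu B / (mu E ^+ 2) <= M%:E ->
  exists E' : set X, [/\ measurable (E' : set (borelType X)), E' `<=` E, 0 < mu E' &
    forall y rho, (0 < rho)%R ->
      mu (E' `&` ball y rho) * mu B <= (2 `^ t * (4 * M) * rho `^ t)%:E * mu E'].
Proof.
move=> t0 M0 oE E0 mB B0 enM.
have mE := measurable_open oE.
have Efin : mu E \is a fin_num by exact: fin_num_measure.
have Bfin : mu B \is a fin_num by exact: fin_num_measure.
pose e := fine (mu E); pose b := fine (mu B).
have e0 : (0 < e)%R by rewrite fine_gt0// E0 ltey_eq Efin.
have b0 : (0 < b)%R by rewrite fine_gt0// B0 ltey_eq Bfin.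
have eE : mu E = e%:E by rewrite fineK.
have bE : mu B = b%:E by rewrite fineK.
have en := energy_le_ratio E0 mE B0 mB enM; rewrite -/e -/b in en.
pose a := (2 * M * e / b)%R.
have a0 : (0 < a)%R by rewrite !divr_gt0// !mulr_gt0.
pose bad : set X := [set y | exists2 rho : R, (0 < rho)%R &
    (a * rho `^ t)%:E < mu (E `&` ball y rho)].
have mbad : measurable (bad : set (borelType X)).
  by apply: measurable_open; exact: open_massive.
have mEb : measurable (E `&` bad : set (borelType X)) by exact: measurableI.
have cheb : a%:E * mu (E `&` bad) <= energy mu t E.
  apply: integral_ge_mul => //.
  - exact: ltW.
  - by move=> y _; apply: integral_ge0 => x _; exact: poweR_ge0.
  move=> y [Ey [rho rho0 lt_a]].
  have mEy : measurable (E `&` ball y rho : set (borelType X)).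
    by apply: measurableI => //; exact: measurable_ballB.
  apply: (@le_trans _ _ ((rho `^ (- t))%:E * mu (E `&` ball y rho))).
    have -> : a%:E = (rho `^ (- t))%:E * (a * rho `^ t)%:E.
      by rewrite -EFinM powRN mulrC mulfK// gt_eqF// powR_gt0.
    by rewrite lee_wpmul2l ?lee_fin ?powR_ge0// ltW.
  apply: integral_ge_mul => //.
  - exact: powR_ge0.
  - by move=> x _; exact: poweR_ge0.
  - by move=> x [_ yx]; exact: kernel_ge.
have half : mu (E `&` bad) <= (e / 2)%:E.
  have := le_trans cheb en; rewrite -lee_pdivlMl// -EFinM => /le_trans; apply.
  by rewrite lee_fin le_eqVlt; apply/orP; left; apply/eqP; rewrite /a; field;
    rewrite !gt_eqF.
pose E' := E `\` bad.
have mE' : measurable (E' : set (borelType X)) by exact: measurableD.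
have E'half : (e / 2)%:E <= mu E'.
  have eD : e%:E = mu E' + mu (E `&` bad) by rewrite -eE (measureDI mu mE mbad).
  have : e%:E <= mu E' + (e / 2)%:E by rewrite eD leeD2l.
  by rewrite -leeBlDr// -EFinB; apply: le_trans; rewrite lee_fin; lra.
exists E'; split => //; first exact: subDsetl.
  by apply: lt_le_trans E'half; rewrite lte_fin divr_gt0.
move=> y rho rho0.
have [->|/set0P[z [[Ez nbz] yz]]] := eqVneq (E' `&` ball y rho) set0.
  by rewrite measure0 mul0e mule_ge0// lee_fin !mulr_ge0 ?powR_ge0// ltW.
have rho20 : (0 < 2 * rho)%R by rewrite mulr_gt0.
have zle : mu (E `&` ball z (2 * rho)) <= (a * (2 * rho) `^ t)%:E.
  by rewrite leNgt; apply/negP => lt_a; apply: nbz; exists (2 * rho)%R.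
apply: (@le_trans _ _ ((a * (2 * rho) `^ t)%:E * mu B)).
  rewrite lee_wpmul2r//; apply: le_trans zle; apply: le_borel_measure.
  - by apply: measurableI => //; exact: measurable_ballB.
  - by apply: measurableI => //; exact: measurable_ballB.
  apply: setISS; first exact: subDsetl.
  by apply: sub_ball; move/in_ball: yz; rewrite metric_sym; lra.
apply: (@le_trans _ _ ((2 `^ t * (4 * M) * rho `^ t)%:E * (e / 2)%:E)); last first.
  by rewrite lee_wpmul2l// lee_fin !mulr_ge0 ?powR_ge0// ltW.
rewrite bE -!EFinM lee_fin powRM//; last exact: ltW.
rewrite le_eqVlt; apply/orP; left; apply/eqP; rewrite /a; field.
by rewrite gt_eqF.
Qed.

End trimming.

(** * Selection of balls and redistribution of mass *)

(** The selection of Vitali's covering lemma: take the index of largest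
    radius, discard the indices near it, and repeat. *)
Lemma greedy_selection (R : realType) (G : seq nat) (rad : nat -> R)
    (near : rel nat) : reflexive near -> symmetric near ->
  exists S : seq nat, [/\ {subset S <= G},
    {in S &, forall m k, m != k -> ~~ near m k} &
    {in G, forall n, exists2 m, m \in S & near n m && (rad n <= rad m)%R}].
Proof.
move=> nearxx nearC; pose ge_rad m n := (rad n <= rad m)%R.
have tot : total ge_rad by move=> m n; exact: le_total.
have tr : transitive ge_rad by move=> n m k mn nk; exact: le_trans nk mn.
wlog : G / sorted ge_rad G.
  move=> /(_ (sort ge_rad G) (sort_sorted tot G))[S [SG sep cov]].
  exists S; split => // [n /SG|n nG]; first by rewrite mem_sort.
  by apply: cov; rewrite mem_sort.
have [k] := ubnP (size G); elim: k G => // k IH [|m G] /=; first by exists [::].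
rewrite ltnS => Gk mG.
have [|S [SG sep cov]] := IH [seq n <- G | ~~ near n m] _
  (sorted_filter tr _ (path_sorted mG)).
  by rewrite size_filter; apply: leq_ltn_trans Gk; rewrite ?count_size.
have mle n : n \in G -> (rad n <= rad m)%R.
  by move=> nG; have /allP/(_ n nG) := order_path_min tr mG.
have SP n : n \in S -> n \in G /\ ~~ near n m.
  by move=> /SG; rewrite mem_filter => /andP[].
exists (m :: S); split => [n|n l|n].
- by rewrite !inE => /predU1P[->|/SP[->]]; rewrite ?eqxx ?orbT.
- rewrite !inE => /predU1P[->|nS] /predU1P[->|lS]; rewrite ?eqxx//.
  + by move=> _; rewrite nearC; have [] := SP l lS.
  + by move=> _; have [] := SP n nS.
  + exact: sep.
- rewrite inE => nmG; have [nm|nnm] := boolP (near n m).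
    exists m; rewrite ?mem_head// nm/=.
    by case/predU1P: nmG => [->|/mle].
  case/predU1P: nmG => [nm|nG]; first by rewrite nm nearxx in nnm.
  have [|l lS nl] := cov n; first by rewrite mem_filter nnm.
  by exists l => //; rewrite inE lS orbT.
Qed.

Section redistribution.
Context {R : realType} {X : pmetricType R}.
Variable mu : probability (borelType X) R.
Variable nu : {measure set (borelType X) -> \bar R}.
Variables (Q E' : nat -> set X).
Hypotheses (mE' : forall m, measurable (E' m : set (borelType X)))
  (E'0 : forall m, 0 < mu (E' m))
  (mQ : forall m, measurable (Q m : set (borelType X)))
  (tQ : trivIset setT Q) (nuT : nu setT < +oo).

Let weight m : R := fine (nu (Q m)) / fine (mu (E' m)).

Let weight_ge0 m : (0 <= weight m)%R.
Proof. by rewrite divr_ge0// fine_ge0. Qed.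

(** The mass of each cell Q m is spread over E' m, proportionally to mu. *)
Definition redistribution (N : nat) : {measure set (borelType X) -> \bar R} :=
  msum (fun m => mscale (NngNum (weight_ge0 m)) (mrestr mu (mE' m))) N.

Lemma redistributionE N A :
  redistribution N A = \sum_(m < N) (weight m)%:E * mu (A `&` E' m).
Proof. by []. Qed.

Lemma borel_fin_num (A : set X) : measurable (A : set (borelType X)) ->
  nu A \is a fin_num.
Proof.
by move=> mA; rewrite ge0_fin_numE//; apply: le_lt_trans nuT; apply: le_borel_measure.
Qed.

Lemma weightE m : (weight m)%:E * mu (E' m) = nu (Q m).
Proof.
have Efin : mu (E' m) \is a fin_num by exact: fin_num_measure.
have e0 : (0 < fine (mu (E' m)))%R by rewrite fine_gt0// E'0 ltey_eq Efin.
by rewrite /weight -[X in _ * X](fineK Efin) -EFinM divfK ?gt_eqF// fineK// borel_fin_num.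
Qed.

Lemma cell_le m (A : set X) : measurable (A : set (borelType X)) ->
  (weight m)%:E * mu (A `&` E' m) <= nu (Q m).
Proof.
move=> mA; rewrite -weightE lee_wpmul2l ?lee_fin//; apply: le_borel_measure => //.
by apply: measurableI.
Qed.

(** The bound for a cell that may be much larger than A, where disjointness of
    the cells gives nothing. *)
Lemma cell_term_le m (A : set X) (b k g : R) :
  measurable (A : set (borelType X)) -> (0 < b)%R ->
  nu (Q m) <= (k * b)%:E -> mu (E' m `&` A) * b%:E <= g%:E * mu (E' m) ->
  (weight m)%:E * mu (A `&` E' m) <= (k * g)%:E.
Proof.
move=> mA b0.
have Efin : mu (E' m) \is a fin_num by exact: fin_num_measure.
have pfin : mu (E' m `&` A) \is a fin_num.
  by apply: fin_num_measure; exact: measurableI.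
have Qfin := borel_fin_num (mQ m).
have e0 : (0 < fine (mu (E' m)))%R by rewrite fine_gt0// E'0 ltey_eq Efin.
rewrite (setIC A) /weight -(fineK Efin) -(fineK pfin) -{1}(fineK Qfin) -!EFinM !lee_fin.
set q := fine (nu _); set e := fine (mu (E' m)) in e0 *.
set p := fine (mu _) => qk pg.
have p0 : (0 <= p)%R by rewrite fine_ge0.
rewrite /= mulrAC ler_pdivrMr//.
apply: (@le_trans _ _ (k * b * p)%R); first by rewrite ler_wpM2r.
have k0 : (0 <= k)%R.
  by rewrite -(pmulr_lge0 _ b0); apply: le_trans qk; rewrite fine_ge0.
by rewrite -!mulrA ler_wpM2l// mulrC.
Qed.

(** The terms of the sum are the masses put on A; each comes from a cell, and
    the cells involved are disjoint and contained in A'. *)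
Lemma sum_cells_le N (P : pred nat) (A A' : set X) :
  measurable (A : set (borelType X)) -> measurable (A' : set (borelType X)) ->
  (forall m, P m -> (A `&` E' m) !=set0 -> Q m `<=` A') ->
  \sum_(m < N | P m) (weight m)%:E * mu (A `&` E' m) <= nu A'.
Proof.
move=> mA mA' PA.
have mQA m : measurable (Q m `&` A' : set (borelType X)) by exact: measurableI.
apply: (@le_trans _ _ (\sum_(m < N) nu (Q m `&` A'))).
  rewrite big_mkcond/=; apply: lee_sum => m _; case: ifPn => // Pm.
  have [->|/set0P AE] := eqVneq (A `&` E' m) set0.
    by rewrite measure0 mule0.
  by rewrite (setIidl (PA m Pm AE)) cell_le.
have tQA : trivIset setT (fun m => Q m `&` A') by exact: trivIset_setIr.
rewrite -(measure_bigsetU nu mQA tQA).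
apply: le_borel_measure => //; first exact: bigsetU_measurable.
by rewrite -(bigcup_mkord N (fun m => Q m `&` A')) => x [m _ []].
Qed.

Lemma redistributionT N :
  redistribution N setT = nu (\bigcup_(m < N) Q m).
Proof.
rewrite redistributionE bigcup_mkord measure_bigsetU//.
by apply: eq_bigr => m _; rewrite setTI weightE.
Qed.

Lemma redistribution_le N (A : set X) : measurable (A : set (borelType X)) ->
  redistribution N A <= (\sum_(m < N) weight m)%:E * mu A.
Proof.
move=> mA; rewrite redistributionE -sumEFin ge0_sume_distrl; last first.
  by move=> m _; rewrite lee_fin.
apply: lee_sum => m _; rewrite lee_wpmul2l ?lee_fin//.
by apply: le_borel_measure => //; exact: measurableI.
Qed.

End redistribution.

Section refinement.
Context {R : realType} {X : pmetricType R}.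
Variable mu : probability (borelType X) R.
Variables (c : nat -> X) (r : nat -> R).
Hypotheses (r0 : forall n, (0 < r n)%R).
Hypothesis rsmall :
  forall e, (0 < e)%R -> exists N, forall n, (N <= n)%N -> (r n < e)%R.
Hypothesis limB : mu (lim_sup_set (fun n => ball (c n) (r n))) = 1.

Definition separated_balls (S : seq nat) : Prop :=
  {in S &, forall m k, m != k -> (2 * (r m + r k) <= mdist (c m) (c k))%R}.

(** By absolute continuity of nu with respect to mu, almost every point of V
    for nu lies in a late ball whose closure is inside V; finitely many of
    these balls carry nu up to eps, and the greedy selection applies to them. Two balls
    count as near when the distance of their centres is less than twice the
    sum of their radii, so that a discarded ball is inside the fivefold
    enlargement of a selected one. *)
Lemma select_balls (nu : {measure set (borelType X) -> \bar R}) (L : R)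
    (V : set X) (d eps : R) (j : nat) :
  open V -> nu (~` V) = 0 ->
  (forall A, measurable (A : set (borelType X)) -> nu A <= L%:E * mu A) ->
  (0 < d)%R -> (0 < eps)%R ->
  exists S : seq nat, [/\
    {in S, forall m, [/\ (j <= m)%N, (r m < d)%R &
      closure (ball (c m) (r m)) `<=` V]},
    separated_balls S &
    nu setT <= nu (\bigcup_(m in [set m | m \in S]) ball (c m) (5 * r m))
      + eps%:E].
Proof.
move=> oV nuV nuL d0 eps0.
pose good m := `[< [/\ (j <= m)%N, (r m < d)%R &
  closure (ball (c m) (r m)) `<=` V] >].
pose G m := if good m then ball (c m) (r m) else set0.
have mG m : measurable (G m : set (borelType X)).
  by rewrite /G; case: ifP => // _; exact: measurable_ballB.
pose U := \bigcup_m G m.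
have mU : measurable (U : set (borelType X)) by exact: bigcup_measurable.
pose Ls := lim_sup_set (fun n => ball (c n) (r n)).
have mLs : measurable (Ls : set (borelType X)) by exact: measurable_limsup_balls.
have mV := measurable_open oV.
have nuT : nu setT < +oo.
  by apply: le_lt_trans (nuL _ measurableT) _; rewrite probability_setT mule1 ltry.
have nufin (A : set X) : measurable (A : set (borelType X)) -> nu A \is a fin_num.
  by move=> mA; rewrite ge0_fin_numE//; apply: le_lt_trans nuT; apply: le_borel_measure.
have nuLs : nu (~` Ls) = 0.
  apply/eqP; rewrite eq_le measure_ge0 andbT.
  apply: le_trans (nuL _ (measurableC mLs)) _.
  by rewrite probability_setC// limB subee// mule0.
have VLU : V `&` Ls `<=` U.
  move=> x [Vx Lx].
  have [N NP] := small_ball_in c rsmall oV Vx.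
  have [N' NP'] := rsmall d0.
  have [n /= mn nx] := Lx (maxn j (maxn N N')) Logic.I.
  move: mn; rewrite !geq_max => /and3P[jn Nn Nn'].
  have gn : good n by apply/asboolP; split => //; [exact: NP'|exact: NP].
  by exists n => //; rewrite /G gn.
have nuTU : nu setT <= nu U.
  apply: (@le_trans _ _ (nu (U `|` (~` V `|` ~` Ls)))).
    apply: le_borel_measure => //; first by do 2?apply: measurableU => //; exact: measurableC.
    move=> x _; have [[Vx Lx]|] := pselect (V x /\ Ls x); first by left; exact: VLU.
    by move=> /not_andP; right.
  apply: le_trans (measureU2 _ _ _) _ => //.
    by apply: measurableU; exact: measurableC.
  rewrite -[leRHS]adde0 leeD2l//; apply: le_trans (measureU2 _ _ _) _.
  - exact: measurableC.
  - exact: measurableC.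
  - have le0 : nu (~` V) + nu (~` Ls) <= 0 by rewrite nuV nuLs adde0.
    exact: le0.
pose F n := \bigcup_(i < n) G i.
have mF n : measurable (F n : set (borelType X)) by exact: bigcup_measurable.
have ndF : nondecreasing_seq F.
  move=> m n mn; apply/subsetPset => x [i /= im Gx]; exists i => //=.
  exact: leq_trans mn.
have UF : \bigcup_n F n = U.
  apply/seteqP; split => [x [n _ [i _ Gx]]|x [i _ Gx]]; first by exists i.
  by exists i.+1 => //; exists i => /=.
have := nondecreasing_cvg_mu (mu := nu) mF (bigcup_measurable (fun n _ => mF n)) ndF.
rewrite UF => cvF.
have : nbhs (nu U) [set v | nu U - eps%:E < v].
  apply: open_ereal_gt'; rewrite lteBlDr// -[ltLHS]adde0 lteD2lE ?lte_fin//.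
  exact: nufin.
move=> /cvF[N _ /(_ N (leqnn N))] /= ltN.
have [||S [SG sep cov]] := @greedy_selection R [seq m <- iota 0 N | good m] r
  (fun m k => mdist (c m) (c k) < 2 * (r m + r k))%R.
- by move=> m; rewrite mdistxx mulr_gt0// addr_gt0.
- by move=> m k; rewrite metric_sym addrC.
exists S; split.
- by move=> m /SG; rewrite mem_filter => /andP[/asboolP].
- by move=> m k mS kS mk; have := sep m k mS kS mk; rewrite -leNgt.
apply: le_trans nuTU _; apply: (@le_trans _ _ (nu (F N) + eps%:E)).
  by rewrite -leeBlDr// ltW.
rewrite leeD2r//; apply: le_borel_measure => //.
  by apply: bigcup_measurable => m _; exact: measurable_ballB.
move=> x [i /= iN]; rewrite /G; case: ifPn => // gi /in_ball ix.
have [|m mS /andP[im rim]] := cov i.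
  by rewrite mem_filter gi mem_iota add0n.
exists m => //; apply/in_ball.
have := metric_triangle (c m) (c i) x; rewrite (metric_sym (c m) (c i)).
move: im rim ix => /=; lra.
Qed.

End refinement.

(** * Frostman bounds for redistributed measures *)

Section frostman.
Context {R : realType} {X : pmetricType R}.
Variable mu : probability (borelType X) R.
Variables (s C D : R).
Hypotheses (C1 : (1 <= C)%R) (D0 : (0 < D)%R).
Hypotheses (up : upper_regular mu s C) (lo : lower_regular mu s C D).
Variables (c : nat -> X) (r : nat -> R).
Hypotheses (r0 : forall n, (0 < r n)%R).
Variables (t u K : R) (E' : nat -> set X).
Hypotheses (u0 : (0 < u)%R) (ut : (u < t)%R) (us : (u < s)%R).
Hypotheses (mE' : forall m, measurable (E' m : set (borelType X)))
  (E'0 : forall m, 0 < mu (E' m))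
  (E'B : forall m, E' m `<=` ball (c m) (r m))
  (E'K : forall m y rho, (0 < rho)%R ->
    mu (E' m `&` ball y rho) * mu (ball (c m) (r m)) <=
    (K * rho `^ t)%:E * mu (E' m)).

Let C0 : (0 < C)%R. Proof. exact: lt_le_trans C1. Qed.

Definition cells (S : seq nat) : nat -> set X :=
  seqDU (fun m => if m \in S then ball (c m) (5 * r m) else set0).

Lemma measurable_cells S m : measurable (cells S m : set (borelType X)).
Proof.
apply: measurableD; last apply: bigsetU_measurable => k _.
  by case: ifP => // _; exact: measurable_ballB.
by case: ifP => // _; exact: measurable_ballB.
Qed.

Lemma cells_sub S m x : cells S m x -> m \in S /\ ball (c m) (5 * r m) x.
Proof. by move=> [+ _]; case: ifP. Qed.

(** Above the scale eta, a cell met by the redistribution in ball y rho is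
    contained in ball y (rho + 6d), and 6d is absorbed by the passage from th
    to th'. Below eta, the selected balls with radius at most rho contribute
    at most the nu-mass of ball y (7 rho), which is of order rho^s, while by
    separation at most one selected ball with radius greater than rho
    matters; its contribution is of order rho^t. *)
Lemma refined_frostman (nu : {measure set (borelType X) -> \bar R})
    (L Lam th th' : R) :
  (0 <= L)%R ->
  (forall A, measurable (A : set (borelType X)) -> nu A <= L%:E * mu A) ->
  (1 <= Lam)%R -> (0 < th)%R -> (th < th')%R -> (1 <= th')%R ->
  (forall y rho, (0 < rho)%R -> nu (ball y rho) <= (Lam * (th * rho) `^ u)%:E) ->
  exists2 d : R, (0 < d)%R & forall S : seq nat,
    {in S, forall m, (r m < d)%R} -> separated_balls c r S ->
    forall N y rho, (0 < rho)%R ->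
      redistribution mu nu (cells S) mE' N (ball y rho) <=
      (Lam * (th' * rho) `^ u)%:E.
Proof.
move=> L0 nuL Lam1 th0 thth' th'1 nuF.
have nuT : nu setT < +oo.
  by apply: le_lt_trans (nuL _ measurableT) _; rewrite probability_setT mule1 ltry.
have tu0 : (0 < t - u)%R by rewrite subr_gt0.
have su0 : (0 < s - u)%R by rewrite subr_gt0.
have half0 : (0 < 2^-1 :> R)%R by rewrite invr_gt0.
(* The nu-mass of a cell is at most k times the mu-measure of its ball. *)
pose k := (L * (C * C * 5 `^ s))%R.
have [h1 h10 h1P] := powR_small (k * K) tu0 half0.
have [h2 h20 h2P] := powR_small (L * (C * 7 `^ s)) su0 half0.
pose eta := Num.min h1 h2.
have eta0 : (0 < eta)%R by rewrite lt_min h10.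
exists (Num.min D ((th' - th) * eta / (6 * th)))%R.
  by rewrite lt_min D0 !divr_gt0 ?mulr_gt0// subr_gt0.
set d := Num.min D _ => S Sd sepS N y rho rho0.
have mQ := measurable_cells S.
have tQ : trivIset setT (cells S) by exact: trivIset_seqDU.
have mb x a : measurable (ball x a : set (borelType X)) by exact: measurable_ballB.
rewrite redistributionE.
have [eta_le|eta_gt] := leP eta rho.
  have d6 : (th * (rho + 6 * d) <= th' * rho)%R.
    have : (d <= (th' - th) * eta / (6 * th))%R by rewrite ge_min lexx orbT.
    rewrite ler_pdivlMr ?mulr_gt0// => dle.
    have : ((th' - th) * eta <= (th' - th) * rho)%R by rewrite ler_wpM2l// subr_ge0 ltW.
    lra.
  have d0 : (0 < d)%R by rewrite lt_min D0 !divr_gt0 ?mulr_gt0// subr_gt0.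
  apply: (@le_trans _ _ (nu (ball y (rho + 6 * d)))).
    apply: (sum_cells_le mE' E'0 mQ tQ nuT N (P := xpredT)) => //.
    move=> m _ [z [yz Ez]] x /cells_sub[mS mx].
    have := Sd m mS; have /in_ball := E'B Ez; move: yz mx => /in_ball + /in_ball + + +.
    have := metric_triangle y z x; have := metric_triangle z (c m) x.
    rewrite (metric_sym z (c m)) => *; apply/in_ball; lra.
  apply: le_trans (nuF _ _ _) _; first by rewrite addr_gt0// mulr_gt0.
  rewrite lee_fin ler_wpM2l//; first by lra.
  by rewrite ge0_ler_powR ?nnegrE ?(ltW u0)// mulr_ge0 ?(ltW th0)//; lra.
have [rho1 rho2] : (rho < h1 /\ rho < h2)%R by apply/andP; rewrite -lt_min.
have rhou0 : (0 < rho `^ u)%R by rewrite powR_gt0.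
apply: (@le_trans _ _ (rho `^ u)%:E); last first.
  rewrite lee_fin -[leLHS]mul1r ler_pM ?powR_ge0//.
  rewrite ge0_ler_powR ?nnegrE ?(ltW u0) ?(ltW rho0)//.
    by rewrite mulr_ge0 ?(ltW rho0)//; lra.
  by rewrite ler_peMl// ltW.
rewrite (bigID (fun m : 'I_N => (r m <= rho)%R))/=.
apply: (@le_trans _ _ ((rho `^ u / 2)%:E + (rho `^ u / 2)%:E)); last first.
  by rewrite -EFinD -splitr.
apply: leeD.
  apply: (@le_trans _ _ (nu (ball y (7 * rho)))).
    apply: (sum_cells_le mE' E'0 mQ tQ nuT N 
      (P := fun m => r m <= rho)%R) => // m rm [z [yz Ez]] x /cells_sub[mS mx].
    have /in_ball := E'B Ez; move: yz mx => /in_ball + /in_ball + +.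
    have := metric_triangle y z x; have := metric_triangle z (c m) x.
    rewrite (metric_sym z (c m)) => *; apply/in_ball; lra.
  apply: le_trans (nuL _ (mb _ _)) _.
  apply: (@le_trans _ _ (L%:E * (C * (7 * rho) `^ s)%:E)).
    by rewrite lee_wpmul2l// up// mulr_gt0.
  rewrite -EFinM lee_fin powRM//; last exact: ltW.
  rewrite (powR_split u s rho0) !mulrA [leRHS]mulrC.
  by rewrite ler_wpM2r ?powR_ge0//; have := h2P _ rho0 rho2; rewrite !mulrA.
have [[m0 [m0S hit0 big0]]|none] := pselect (exists m : 'I_N,
    [/\ nat_of_ord m \in S, ball y rho `&` E' m !=set0 & (rho < r m)%R]); last first.
  rewrite big1 ?lee_fin ?divr_ge0 ?powR_ge0// => m; rewrite -ltNge => big.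
  have [E0|/set0P hit] := eqVneq (ball y rho `&` E' m) set0.
    by rewrite E0 measure0 mule0.
  suff -> : cells S m = set0 by rewrite measure0 mul0r mul0e.
  rewrite -subset0 => x /cells_sub[mS _]; apply: none; exists m; split => //.
(* If two balls of radius greater than rho both met ball y rho, their centres
   would be closer than twice the sum of the radii. *)
have uniq (m : 'I_N) : nat_of_ord m \in S -> ball y rho `&` E' m !=set0 ->
    (rho < r m)%R -> m = m0.
  move=> mS [z [yz Ez]] big; apply/eqP/contraT => mm0.
  have /(_ _ _ m0S mS) := sepS; rewrite eq_sym => /(_ mm0).
  case: hit0 => z0 [yz0 Ez0].
  have := E'B Ez; have := E'B Ez0; move: yz yz0.
  move=> /in_ball + /in_ball + /in_ball + /in_ball.
  have := metric_triangle (c m0) z0 (c m); have := metric_triangle z0 y (c m).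
  have := metric_triangle y z (c m).
  rewrite (metric_sym z0 y) (metric_sym z (c m)) => *; exfalso; lra.
rewrite (bigD1 m0)/= -?ltNge// big1 ?adde0; last first.
  move=> m /andP[]; rewrite -ltNge => big mm0.
  have [E0|/set0P hit] := eqVneq (ball y rho `&` E' m) set0.
    by rewrite E0 measure0 mule0.
  suff -> : cells S m = set0 by rewrite measure0 mul0r mul0e.
  rewrite -subset0 => x /cells_sub[mS _].
  by move/eqP: mm0; apply; exact: uniq.
have b0 := ball_measure_gt0 (c m0) C1 D0 lo (r0 m0).
have bfin : mu (ball (c m0) (r m0)) \is a fin_num by exact: fin_num_measure.
have rD : (r m0 <= D)%R by apply: le_trans (ltW (Sd m0 m0S)) _; rewrite ge_min lexx.
apply: (@le_trans _ _ (k * (K * rho `^ t))%:E); last first.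
  rewrite lee_fin (powR_split u t rho0) !mulrA [leRHS]mulrC.
  by rewrite ler_wpM2r ?powR_ge0//; have := h1P _ rho0 rho1; rewrite ?mulrA.
apply: (cell_term_le (b := fine (mu (ball (c m0) (r m0)))) mE' E'0 mQ nuT) => //.
- by rewrite fine_gt0// b0 ltey_eq bfin.
- apply: le_trans (nuL _ (mQ _)) _.
  rewrite EFinM fineK// /k.
  apply: (@le_trans _ _ (L%:E * (C * (5 * r m0) `^ s)%:E)).
    rewrite lee_wpmul2l//; apply: le_trans (up _ _); last by rewrite mulr_gt0.
    apply: le_borel_measure; [exact: mQ|exact: measurable_ballB|].
    by move=> x /cells_sub[_ h]; exact: h.
  rewrite (EFinM L) -muleA lee_wpmul2l//.
  apply: (@le_trans _ _ ((C * C * 5 `^ s)%:E * (C^-1 * r m0 `^ s)%:E)); last first.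
    by rewrite lee_wpmul2l ?lo// lee_fin !mulr_ge0 ?powR_ge0// ltW.
  rewrite -EFinM lee_fin powRM// ?(ltW (r0 _))// le_eqVlt; apply/orP; left.
  by apply/eqP; field; rewrite gt_eqF.
- by rewrite fineK// E'K.
Qed.

End frostman.

(** * The Cantor construction *)

Section mass_transference.
Context {R : realType} {X : pmetricType R}.
Variable mu : probability (borelType X) R.
Variables (s C D : R).
Hypotheses (C1 : (1 <= C)%R) (D0 : (0 < D)%R).
Hypotheses (up : upper_regular mu s C) (lo : lower_regular mu s C D).
Variables (c : nat -> X) (r : nat -> R).
Hypotheses (r0 : forall n, (0 < r n)%R).
Hypothesis rsmall :
  forall e, (0 < e)%R -> exists N, forall n, (N <= n)%N -> (r n < e)%R.
Hypothesis limB : mu (lim_sup_set (fun n => ball (c n) (r n))) = 1.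
Variables (t u K : R) (E E' : nat -> set X).
Hypotheses (u0 : (0 < u)%R) (ut : (u < t)%R) (us : (u < s)%R).
Hypotheses (oE : forall m, open (E m)) (EB : forall m, E m `<=` ball (c m) (r m)).
Hypotheses (mE' : forall m, measurable (E' m : set (borelType X)))
  (E'0 : forall m, 0 < mu (E' m))
  (E'E : forall m, E' m `<=` E m)
  (E'K : forall m y rho, (0 < rho)%R ->
    mu (E' m `&` ball y rho) * mu (ball (c m) (r m)) <=
    (K * rho `^ t)%:E * mu (E' m)).

Let C0 : (0 < C)%R. Proof. exact: lt_le_trans C1. Qed.

(** The factor th is bounded by 2 but not fixed, so that it can increase
    at each refinement while one Frostman bound holds for all of them. *)
Definition frostman_pair
    (p : set X * {measure set (borelType X) -> \bar R}) : Prop :=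
  [/\ open p.1, p.2 (~` p.1) = 0,
    (exists2 L : R, (0 <= L)%R &
      forall A, measurable (A : set (borelType X)) -> p.2 A <= L%:E * mu A),
    (exists2 th : R, (0 < th)%R && (th < 2)%R &
      forall y rho, (0 < rho)%R -> p.2 (ball y rho) <= (C * (th * rho) `^ u)%:E) &
    2^-1%:E < p.2 setT].

Lemma closed_finite_balls (S : seq nat) :
  closed (\bigcup_(m in [set m | m \in S]) closure (ball (c m) (r m))).
Proof.
apply: closed_bigcup => [|m _]; last exact: closed_closure.
exact: finite_seq.
Qed.

(** One step of the Cantor construction, with th' halfway between th and 2
    and a loss of half of the mass in excess of 1/2. *)
Lemma refine_pair p (j : nat) : frostman_pair p ->
  exists q, [/\ frostman_pair q, closure q.1 `<=` p.1 &
    q.1 `<=` \bigcup_(n >= j) E n].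
Proof.
case: p => V nu [/= oV nuV [L L0 nuL] [th /andP[th0 th2] nuF] nu1].
have nuT : nu setT < +oo.
  by apply: le_lt_trans (nuL _ measurableT) _; rewrite probability_setT mule1 ltry.
have nufin : nu setT \is a fin_num by rewrite ge0_fin_numE.
pose th' := ((th + 2) / 2)%R.
have [thth' th'1 th'2] : [/\ th < th', 1 <= th' & th' < 2]%R.
  by split; rewrite /th'; lra.
have E'B m : E' m `<=` ball (c m) (r m) by move=> x /E'E/EB.
have [d d0 dP] := refined_frostman C1 D0 up lo r0 u0 ut us mE' E'0 E'B E'K
  L0 nuL C1 th0 thth' th'1 nuF.
pose v := fine (nu setT); have vE : nu setT = v%:E by rewrite fineK.
have v1 : (2^-1 < v)%R by rewrite -lte_fin -vE.
have eps0 : (0 < (v - 2^-1) / 2)%R by rewrite divr_gt0// subr_gt0.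
have [S [SP sepS massS]] := select_balls r0 rsmall limB j oV nuV nuL d0 eps0.
pose N := (\max_(m <- S) m).+1.
have SN m : m \in S -> (m < N)%N.
  by move=> mS; rewrite ltnS; exact: (@leq_bigmax_seq _ S xpredT id).
have mQ := measurable_cells c r S.
have tQ : trivIset setT (cells c r S) by exact: trivIset_seqDU.
exists (\bigcup_(m in [set m | m \in S]) E m,
        redistribution mu nu (cells c r S) mE' N); split => /=.
- split => /=.
  + by apply: bigcup_open => m _; exact: oE.
  + apply/eqP; rewrite eq_le measure_ge0 andbT -(measure0 nu) redistributionE.
    apply: (sum_cells_le mE' E'0 mQ tQ nuT N (P := xpredT)) => // [|m _ [x [nVx Ex]] y].
      by apply: measurableC; apply: measurable_open; apply: bigcup_open => m _; exact: oE.
    by move=> /cells_sub[mS _]; apply: nVx; exists m => //; exact: E'E.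
  + eexists; last by move=> A mA; exact: redistribution_le mA.
    by apply: sumr_ge0 => m _; rewrite divr_ge0// fine_ge0.
  + exists th'; first by rewrite th'2 andbT; lra.
    by move=> y rho rho0; apply: dP => // m /SP[].
  + rewrite redistributionT//.
    apply: (@lt_le_trans _ _ (v%:E - ((v - 2^-1) / 2)%:E)).
      by rewrite -EFinB lte_fin; lra.
    rewrite leeBlDr// -vE; apply: le_trans massS _; rewrite leeD2r//.
    apply: le_borel_measure.
    * by apply: bigcup_measurable => m _; exact: measurable_ballB.
    * by apply: bigcup_measurable => m _; exact: mQ.
    rewrite bigcup_mkord -bigsetU_seqDU => x [m /= mS mx].
    rewrite -(bigcup_mkord N (fun k => if k \in S then ball (c k) (5 * r k) else set0)).
    by exists m => /=; [exact: SN|rewrite mS].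
- apply: subset_trans (_ : \bigcup_(m in [set m | m \in S]) closure (ball (c m) (r m)) `<=` _).
    rewrite closureE => x; apply; split; first exact: closed_finite_balls.
    by move=> y [m mS Ey]; exists m => //; apply: subset_closure; exact: EB.
  by move=> x [m /SP[_ _ clV] mx]; exact: clV.
- by move=> x [m /SP[jm _ _] Ex]; exists m.
Qed.

(** The mass distribution principle along the Cantor construction:
    compactness lets finitely many balls of the cover contain the open set of
    some stage, so that the measure of that stage does the work of a limit. *)
Lemma limsup_covering_sum (x : nat -> X) (rho : nat -> R) :
  compact [set: X] -> (forall i, (0 < rho i)%R) ->
  lim_sup_set E `<=` \bigcup_i ball (x i) (rho i) ->
  exists n, (2^-1 < \sum_(i < n) C * (2 * rho i) `^ u)%R.
Proof.
move=> cX rho0 cover.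
have [||f fP] := @nested_choice X _ fst frostman_pair
  (fun j => \bigcup_(n >= j) E n) (setT, mu : {measure set (borelType X) -> \bar R}).
- split => /=.
  + exact: openT.
  + by rewrite setCT measure0.
  + by exists 1%R => // A mA; rewrite mul1e.
  + exists 1%R => [|y h h0]; first by rewrite ltr01/=; lra.
    rewrite mul1r; have [h1|h1] := leP h 1%R.
      apply: le_trans (up y h0) _; rewrite lee_fin ler_wpM2l// ?(ltW C0)//.
      by rewrite ger_powR ?h0//= ltW.
    apply: le_trans (probability_le1 _ (measurable_ballB _ _)) _.
    rewrite lee_fin -[leLHS]mulr1 ler_pM//.
    by rewrite -(powRr0 h) ler_powR// ltW.
  + by rewrite probability_setT lte_fin; lra.
- by move=> j p pP; exact: refine_pair.
have [|i|y fy|n nP] := @nested_cover X (fun j => (f j).1)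
    (fun i => ball (x i) (rho i)) cX.
- by move=> j; have [] := fP j.
- exact: open_ballB.
- by apply: cover => n _; have [_ _] := fP n; apply; exact: fy.
exists n; have [[oV nuV _ [th /andP[th0 th2] nuF] nu1] _ _] := fP n.
rewrite -lte_fin; apply: lt_le_trans nu1 _; rewrite -sumEFin.
set nu := (f n).2 in nuV nuF *; set V := (f n).1 in oV nuV nP.
apply: (@le_trans _ _ (nu V)).
  have le : nu (V `|` ~` V) <= nu V + nu (~` V).
    exact: measureU2 (measurable_open oV) (measurableC (measurable_open oV)).
  by move: le; rewrite setUv nuV adde0.
apply: le_trans (measure_le_sum nu (measurable_open oV) _ nP) _.
  by move=> i; exact: measurable_ballB.
apply: lee_sum => i _; apply: le_trans (nuF _ _ (rho0 i)) _.
rewrite lee_fin ler_wpM2l// ?(ltW C0)// ge0_ler_powR ?(ltW u0)// ?nnegrE.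
- by rewrite mulr_ge0// ltW.
- by rewrite mulr_ge0// ltW.
- by rewrite ler_wpM2r// ltW.
Qed.

End mass_transference.

(** * Covers from Hausdorff measure zero *)

Lemma sum_half_powers (R : realFieldType) n :
  (\sum_(i < n) 2^-1 ^+ i.+1 = 1 - 2^-1 ^+ n :> R)%R.
Proof.
elim: n => [|n IH]; first by rewrite big_ord0 expr0 subrr.
by rewrite big_ord_recr/= IH exprS; field.
Qed.

Section hausdorff.
Context {R : realType} {X : pmetricType R}.

(** A covering set of diameter a is enclosed in a ball of radius rho, where
    rho^u = a^u + eps / 2^(i + 2); as u > 0, empty covering sets and sets of
    diameter 0 contribute eps / 2^(i + 2) only. *)
Lemma hausdorff_measure0_cover (v u eps : R) (A : set X) :
  (0 <= v)%R -> (v < u)%R -> (0 < eps)%R -> hausdorff_measure v A = 0 ->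
  exists (x : nat -> X) (rho : nat -> R), [/\ forall i, (0 < rho i)%R,
    A `<=` \bigcup_i ball (x i) (rho i) &
    forall n, (\sum_(i < n) rho i `^ u <= eps)%R].
Proof.
move=> v0 vu eps0 A0; have u0 : (0 < u)%R by exact: le_lt_trans vu.
have un0 : (u != 0)%R by rewrite gt_eqF.
have eps20 : (0 < eps / 2)%R by rewrite divr_gt0.
have : hausdorff_content v 1 A < (eps / 2)%:E.
  apply: le_lt_trans (_ : 0 < _); last by rewrite lte_fin.
  by rewrite -A0; apply: ereal_sup_ubound; exists 1%R => /=.
move=> /ereal_inf_lt[_ [U [AU U1] <-] sumU].
pose a i := fine (diam (U i)).
have afin i : diam (U i) \is a fin_num.
  by rewrite ge0_fin_numE ?diam_ge0//; apply: le_lt_trans (U1 i) _; rewrite ltry.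
have aE i : diam (U i) = (a i)%:E by rewrite fineK.
have a0 i : (0 <= a i)%R by rewrite -lee_fin -aE diam_ge0.
have a1 i : (a i <= 1)%R by rewrite -lee_fin -aE.
pose e i := (eps / 2 * 2^-1 ^+ i.+1)%R.
have e0 i : (0 < e i)%R by rewrite mulr_gt0// exprn_gt0.
pose rho i := ((a i `^ u + e i) `^ u^-1)%R.
have ae0 i : (0 < a i `^ u + e i)%R by rewrite ltr_wpDl// powR_ge0.
have rhoE i : (rho i `^ u = a i `^ u + e i)%R.
  by rewrite /rho -powRrM mulVf// powRr1// ltW.
have arho i : (a i < rho i)%R.
  have -> : a i = ((a i `^ u) `^ u^-1)%R by rewrite -powRrM mulfV// powRr1.
  by rewrite gt0_ltr_powR ?invr_gt0 ?nnegrE ?powR_ge0// ?ltrDl// ltW.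
have /choice[x xP] i : exists x, U i !=set0 -> U i x.
  by have [[x Ux]|nU] := pselect (U i !=set0); [exists x|exists point].
exists x, rho; split.
- by move=> i; rewrite powR_gt0.
- move=> y /AU[i _ Uy]; exists i => //; apply/in_ball; apply: le_lt_trans (arho i).
  rewrite -lee_fin -aE; apply: le_diam => //; apply: xP; by exists y.
move=> n; under eq_bigr do rewrite rhoE.
rewrite big_split/= -mulr_sumr sum_half_powers.
have le1 : (eps / 2 * (1 - 2^-1 ^+ n) <= eps / 2)%R.
  by rewrite ler_piMr ?(ltW eps20)// gerBl exprn_ge0.
have le2 : (\sum_(i < n) a i `^ u <= eps / 2)%R; last by lra.
rewrite -lee_fin; apply: le_trans (ltW sumU).
rewrite esum_mkcond -nneseries_esumT; last first.
  by move=> i; case: ifP => // _; exact: poweR_ge0.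
apply: le_trans (nneseries_lim_ge (m := 0) n _); last first.
  by move=> i _ _; case: ifP => // _; exact: poweR_ge0.
rewrite big_mkord -sumEFin; apply: lee_sum => i _.
case: ifPn => [_|].
  rewrite aE poweR_EFin lee_fin.
  have [->|ai0] := eqVneq (a i) 0%R; first by rewrite powR0// powR_ge0.
  by apply: ger_powR; [rewrite a1 andbT lt_def ai0 a0|exact: ltW].
rewrite notin_setE => nU; suff -> : a i = 0%R by rewrite powR0.
have U0 : U i = set0 by apply: contrapT => /eqP/set0P.
apply/EFin_inj; rewrite -aE U0 /diam (_ : 0 |` _ = [set 0]) ?ereal_sup1//.
by apply/seteqP; split => [z [->//|[y []]]|z ->]; left.
Qed.

End hausdorff.

Theorem corollary1p1 (R : realType) (X : pmetricType R)
  (mu : probability (borelType X) R) (s : R)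
  (c : nat -> X) (r : nat -> R) (E : nat -> set X) :
  (0 < s)%R ->
  compact [set: X] ->
  0 < diam [set: X] ->
  ahlfors_regular mu s ->
  (forall n, (0 < r n)%R) ->
  nonincreasing_seq (fun n => diam (ball (c n) (r n))) ->
  diam (ball (c n) (r n)) @[n --> \oo] --> 0 ->
  (forall n, [/\ open (E n), E n !=set0 & E n `<=` ball (c n) (r n)]) ->
  mu (lim_sup_set (fun n => ball (c n) (r n))) = 1 ->
  energy_exponent mu (fun n => ball (c n) (r n)) E
    <= hausdorff_dim (lim_sup_set E)
  /\ packing_dim (lim_sup_set E) = s%:E.
Proof.
move=> s0 cX dX reg r0 _ dr EB limB.
have [C [D [C1 D0 up lo]]] := ahlfors_bounds s0 dX reg.
have rsmall := radius_small s0 C1 D0 up lo r0 dr.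
split; last first.
  apply/eqP; rewrite eq_le; apply/andP; split.
    exact: packing_dim_le s0 C1 D0 lo _.
    by have := packing_dim_ge C1 D0 up lo cX rsmall limB EB.
apply: ge_ereal_sup => _ [t [t0 supt] <-].
apply: le_ereal_inf_tmp => _ [v [v0 Hv] <-].
rewrite lee_fin leNgt; apply/negP => vt.
have t_gt0 : (0 < t)%R by exact: le_lt_trans vt.
have oE n : open (E n) by have [] := EB n.
have mE n := measurable_open (oE n).
have E0 n : 0 < mu (E n).
  by have [oEn En0 _] := EB n; exact: (open_measure_gt0 C1 D0 lo oEn En0).
have B0 n : 0 < mu (ball (c n) (r n)).
  exact: (ball_measure_gt0 (c n) C1 D0 lo (r0 n)).
have [M M0 ratio] : exists2 M : R, (0 < M)%R & forall n,
    energy mu t (E n) * mu (ball (c n) (r n)) / (mu (E n) ^+ 2) <= M%:E.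
  have sup_le n : energy mu t (E n) * mu (ball (c n) (r n)) / (mu (E n) ^+ 2) <=
      ereal_sup [set energy mu t (E n) * mu (ball (c n) (r n)) /
        (mu (E n) ^+ 2) | n in setT].
    by apply: ereal_sup_ubound; exists n.
  move: supt sup_le; case: (ereal_sup _) => [m _ sup_le|//|_ sup_le].
    exists (Num.max 1 m)%R; first by rewrite lt_max ltr01.
    by move=> n; apply: le_trans (sup_le n) _; rewrite lee_fin le_max lexx orbT.
  by exists 1%R => // n; apply: le_trans (sup_le n) _; rewrite leNye.
have ts : (t <= s)%R.
  rewrite leNgt; apply/negP => st; have [_ En0 _] := EB 0%N.
  have := energy_le_ratio (E0 0%N) (mE 0%N) (B0 0%N) (measurable_ballB _ _) (ratio 0%N).
  by rewrite (energy_infty C1 D0 lo t_gt0 st (oE 0%N) En0).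
have /choice[E' E'P] n :=
  trimmed_set t_gt0 M0 (oE n) (E0 n) (measurable_ballB (c n) (r n)) (B0 n) (ratio n).
pose u := ((v + t) / 2)%R.
have [vu ut] : (v < u /\ u < t)%R by split; rewrite /u; lra.
have u0 : (0 < u)%R by exact: le_lt_trans vu.
have us : (u < s)%R by exact: lt_le_trans ts.
have C0 : (0 < C)%R by lra.
have g0 : (0 < C * 2 `^ u)%R by rewrite mulr_gt0// powR_gt0.
pose eps := (2^-1 / (C * 2 `^ u))%R.
have eps0 : (0 < eps)%R by rewrite divr_gt0.
have [x [rho [rho0 cover small]]] := hausdorff_measure0_cover v0 vu eps0 Hv.
have [n] : exists n, (2^-1 < \sum_(i < n) C * (2 * rho i) `^ u)%R.
  apply: (limsup_covering_sum (t := t) (E' := E') C1 D0 up lo r0 rsmall limB) cover => //.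
  - by move=> m; have [] := EB m.
  - by move=> m; have [] := E'P m.
  - by move=> m; have [] := E'P m.
  - by move=> m; have [] := E'P m.
  - by move=> m y h h0; have [_ _ _] := E'P m; apply.
have -> : (\sum_(i < n) C * (2 * rho i) `^ u =
    (C * 2 `^ u) * \sum_(i < n) rho i `^ u)%R.
  rewrite mulr_sumr; apply: eq_bigr => i _.
  by rewrite powRM ?(ltW (rho0 i))// mulrA.
by rewrite ltNge => /negP; apply; rewrite mulrC -ler_pdivlMr.
Qed.
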